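(* Let $X$ be one of the spaces $L^\infty(\Omega)$, $BC^0(\Omega)$, $L^\infty(\Omega)\cap UC(\Omega)$, equipped with the supremum norm. Let $\rho, C_0, t>0$ be constants, and let $S$ be a linear operator with $S:X\to X$ and $S:X_\rho\to X_\rho$ such that $$\|S(u)-S(v)\|_\infty\le C_0\|u-v\|_\infty\quad\text{for all }u,v\in X,$$ $$\|S(u)\|_{\infty,\rho}\le C_0e^{-t}\|u\|_{\infty,\rho}\quad\text{for all }u\in X_\rho.$$ Then $S$ maps $X_k$ into $X_l$ for all real $0<l<k$, and there exists a constant $C_1>0$ depending on $k$ and $\rho$ such that for all $v\in X_k$ $$\|Sv\|_{\infty,l}\le\frac{C_0C_1}{(1+t)^{k-l}}\|v\|_{\infty,k}.$$
   Context: $\Omega\subset\mathbb{R}^n$ is an unbounded measurable set. $BC^0(\Omega)$ is the space of bounded continuous functions on $\Omega$, and $UC(\Omega)$ is the set of uniformly continuous functions on $\Omega$. For $k>0$, $L^{\infty,k}$ is the space of $u\in L^\infty(\Omega)$ with $\|u\|_{\infty,k}=\operatorname{ess\,sup}_{x\in\Omega}(1+|x|)^k|u(x)|<\infty$ (and similarly with $l$ in place of $k$). For $\rho>0$, $L^{\infty,\rho}$ is the space of $u\in L^\infty(\Omega)$ with $\|u\|_{\infty,\rho}=\operatorname{ess\,sup}_{x\in\Omega}e^{\rho|x|}|u(x)|<\infty$. Set $X_k=X\cap L^{\infty,k}$, $X_l=X\cap L^{\infty,l}$, $X_\rho=X\cap L^{\infty,\rho}$ with these norms. The subscript $\rho$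 always denotes the exponential weight, while $k,l$ denote algebraic weights. *)

(* Defs.v *)
From HB Require Import structures.
From mathcomp Require Import all_boot all_order all_algebra.
From mathcomp Require Import all_classical all_reals all_analysis.

Set Implicit Arguments.
Unset Strict Implicit.
Unset Printing Implicit Defensive.

Import Order.TTheory GRing.Theory Num.Theory.
Import numFieldNormedType.Exports.

Local Open Scope classical_set_scope.
Local Open Scope ring_scope.

Section lebesgue_outer_measure.
Context (R : realType) (n : nat).
Local Open Scope ereal_scope.

(* The open box with lower corner I.1 and upper corner I.2; it is empty, and
   its volume is 0, as soon as I.2 0 i <= I.1 0 i for some i. *)
Definition box (I : 'rV[R]_n.+1 * 'rV[R]_n.+1) : set 'rV[R]_n.+1 :=
  [set x | forall i, (I.1 0%R i < x 0%R i < I.2 0%R i)%R].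

Definition volume (I : 'rV[R]_n.+1 * 'rV[R]_n.+1) : \bar R :=
  (\prod_i Num.max 0 (I.2 0 i - I.1 0 i))%:E.

(* The space is R^(n+1): in dimension 0 every box would be a point of volume 1
   and the formula below would not give measure 0 to the empty set. *)
Definition lebesgue_outer (A : set 'rV[R]_n.+1) : \bar R :=
  ereal_inf [set \sum_(k <oo) volume (F k) |
               F in [set F | A `<=` \bigcup_k box (F k)]].

Let volume_ge0 I : 0 <= volume I.
Proof. by rewrite lee_fin prodr_ge0// => i _; rewrite le_max lexx. Qed.

Let lebesgue_outer_ge0 A : 0 <= lebesgue_outer A.
Proof. by apply: le_ereal_inf_tmp => _ [F _ <-]; exact: nneseries_ge0. Qed.

Let lebesgue_outer0 : lebesgue_outer set0 = 0.
Proof.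
apply/eqP; rewrite eq_le lebesgue_outer_ge0 andbT.
apply: ereal_inf_lbound; exists (fun=> (0, 0)%R); first exact: sub0set.
apply: eseries0 => k _ _.
by rewrite /volume/= big_ord_recl/= subrr maxxx mul0r.
Qed.

Let le_lebesgue_outer :
  {homo lebesgue_outer : A B / A `<=` B >-> A <= B}.
Proof.
move=> A B AB; apply/ereal_inf_le_tmp => _ [F BF <-].
by exists F => //; exact: subset_trans AB BF.
Qed.

Let lebesgue_outer_sigma_subadditive : sigma_subadditive lebesgue_outer.
Proof.
move=> A; have [[i ioo]|] := pselect (exists i, lebesgue_outer (A i) = +oo).
  by rewrite (eseries_pinfty _ _ ioo) ?leey// => k _; rewrite -ltNye
    (lt_le_trans _ (lebesgue_outer_ge0 _)).
rewrite -forallNE => Aoo.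
suff add2e (e : {posnum R}) : lebesgue_outer (\bigcup_n A n) <=
    \sum_(i <oo) lebesgue_outer (A i) + e%:num%:E.
  by apply/lee_addgt0Pr => _/posnumP[].
apply: le_trans (epsilon_trick _ _ _) => //.
pose P m (F : nat -> 'rV[R]_n.+1 * 'rV[R]_n.+1) :=
  A m `<=` \bigcup_k box (F k) /\
  \sum_(k <oo) volume (F k) <=
    lebesgue_outer (A m) + (e%:num / (2 ^ m.+1)%:R)%:E.
have [G PG] : {G & forall m, P m (G m)}.
  apply: (@choice _ _ P) => m.
  have fA : lebesgue_outer (A m) \is a fin_num.
    by rewrite ge0_fin_numE// ltey; exact/eqP/Aoo.
  have em : (0 < e%:num / (2 ^ m.+1)%:R :> R)%R by [].
  have [_ [F AF <-] FA] := lb_ereal_inf_adherent em fA.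
  by exists F; split => //; exact: ltW.
have vG_ge0 x : 0 <= (volume \o uncurry G) x by exact: volume_ge0.
apply: (@le_trans _ _ (\esum_(i in setT) (volume \o uncurry G) i)).
  apply: ereal_inf_lbound => /=.
  have /card_esym/ppcard_eqP[f] := card_nat2.
  exists (uncurry G \o f).
    move=> t [i _ /(PG i).1[j _ Gijt]].
    by exists (f^-1%FUN (i, j)) => //=; rewrite invK ?inE.
  rewrite -(esum_pred_image (volume \o uncurry G) _ xpredT) ?[fun=> _]set_true//.
  by rewrite image_eq.
rewrite (_ : esum _ _ = \sum_(i <oo) \sum_(j <oo) volume (G i j)); last first.
  pose J : nat -> set (nat * nat) := fun i => [set (i, j) | j in setT].
  rewrite (_ : setT = \bigcup_k J k); last first.
    by rewrite predeqE => -[a b]; split => // _; exists a => //; exists b.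
  rewrite esum_bigcupT /=; last 2 first.
    - apply/trivIsetP => i j _ _ ij.
      rewrite predeqE => -[l m] /=; split => //= -[] [_] _ [<-{l} _].
      by move=> [m' _] [] /esym/eqP; rewrite (negbTE ij).
    - by move=> /= [l m]; exact: volume_ge0.
  rewrite -(image_id [set: nat]) -fun_true esum_pred_image//; last first.
    by move=> i _; exact: esum_ge0.
  apply: eq_eseriesr => /= j _.
  rewrite -(esum_pred_image (volume \o uncurry G) (pair j) predT)//=; last first.
    by move=> ? ? _ _; exact: (@can_inj _ _ _ snd).
  by congr esum; rewrite predeqE => -[a b]; split; move=> [i _ <-]; exists i.
apply: lee_nneseries => [i _ _|i _]; first exact: nneseries_ge0.
exact: (PG i).2.
Qed.

HB.instance Definition _ := isOuterMeasure.Build R 'rV[R]_n.+1 lebesgue_outer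
  lebesgue_outer0 lebesgue_outer_ge0 le_lebesgue_outer
  lebesgue_outer_sigma_subadditive.

End lebesgue_outer_measure.

(* R^(n+1) with the sigma-algebra of its Lebesgue measurable sets; as a type it
   is 'rV[R]_n.+1. *)
Notation euclidean R n := (caratheodory_type (@lebesgue_outer R n)).

Definition lebesgue (R : realType) (n : nat) :
  set (euclidean R n) -> \bar R := @lebesgue_outer R n.

HB.instance Definition _ (R : realType) (n : nat) :=
  isMeasure.Build _ (euclidean R n) R (@lebesgue R n)
    (@caratheodory_measure0 R _ (@lebesgue_outer R n))
    (@caratheodory_measure_ge0 R _ (@lebesgue_outer R n))
    (@caratheodory_measure_sigma_additive R _ (@lebesgue_outer R n)).

Definition enorm (R : realType) (n : nat) (x : 'rV[R]_n.+1) : R :=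
  Num.sqrt (\sum_i x 0 i ^+ 2).

Section function_spaces.
Context (R : realType) (n : nat) (Omega : set (euclidean R n)).
Variable (mOmega : measurable Omega).

Definition lebesgue_on : {measure set (euclidean R n) -> \bar R} :=
  mrestr (@lebesgue R n) mOmega.

(* Elements of Linfty are functions on the whole of R^(n+1), but they matter
   only up to lebesgue_on-a.e. equality, i.e., a.e. equality on Omega: the norms
   and the sets BC0 and UC below depend only on the a.e. class. *)
Definition Linfty : Type := LfunType lebesgue_on (leey 1%E).

HB.instance Definition _ := GRing.Lmodule.on Linfty.

Implicit Types (u : Linfty) (X : set Linfty).

Definition supnorm u : \bar R := 'N[lebesgue_on]_+oo[EFin \o u].

(* BC0 and LinftyUC are sets of a.e. classes, and their sup-norm is supnorm, the
   essential supremum. It is the supremum of |f| over Omega for the continuous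
   representative f as soon as Omega has no nonempty relatively open null
   subset. *)
Definition BC0 : set Linfty := [set u | exists f : 'rV[R]_n.+1 -> R,
  [/\ {within Omega, continuous f}, [bounded f x | x in Omega]
    & ae_eq lebesgue_on setT u f]].

Definition LinftyUC : set Linfty := [set u | exists f : 'rV[R]_n.+1 -> R,
  unif_continuous (f : subspace Omega -> R) /\ ae_eq lebesgue_on setT u f].

(* 'N[mu]_+oo[g] is ess_sup mu (abse \o g), or 0 if mu is the zero measure. *)
Definition wnorm (w : 'rV[R]_n.+1 -> R) u : \bar R :=
  'N[lebesgue_on]_+oo[(fun x => (w x * `|u x|)%R%:E)].

Definition algnorm (k : R) := wnorm (fun x => (1 + enorm x) `^ k).

Definition expnorm (rho : R) := wnorm (fun x => expR (rho * enorm x)).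

Definition algspace X (k : R) : set Linfty :=
  X `&` [set u | (algnorm k u < +oo)%E].

Definition expspace X (rho : R) : set Linfty :=
  X `&` [set u | (expnorm rho u < +oo)%E].

(* Linearity on X of an operator on a.e. classes. Compatibility of S with a.e.
   equality is not required separately: it follows from a Lipschitz bound for
   supnorm. *)
Definition linear_on X (S : Linfty -> Linfty) :=
  forall (a : R) u v, X u -> X v ->
    ae_eq lebesgue_on setT (S (a *: u + v)) (a *: S u + S v : Linfty).

End function_spaces.

Arguments Linfty {R n Omega} mOmega.
Arguments BC0 {R n Omega} mOmega _.
Arguments LinftyUC {R n Omega} mOmega _.

(* Main.v *)
Require Import Defs.
From mathcomp Require Import all_boot all_order all_algebra.
From mathcomp Require Import all_classical all_reals all_analysis.
From mathcomp Require Import ess_sup_inf measurable_realfun.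
From mathcomp Require Import ring lra.

Import Order.TTheory GRing.Theory Num.Theory.
Import numFieldNormedType.Exports.

Local Open Scope classical_set_scope.
Local Open Scope ring_scope.

(** The proof interpolates between the sup-norm bound and the exponential
    bound. Let [N] be the algebraic norm of [v]. For every radius [M >= 0] soft
    thresholding at height [e = N / (1 + M) ^ k] writes [v = w + (v - w)], with
    [|v - w| <= e] everywhere and [w = 0] wherever [|v| <= e], hence almost
    everywhere outside the ball of radius [M]. So [w] has a finite exponential
    norm, at most [A * exp (rho * M) * e] with [A = (1 + k / rho) ^ k]
    ([soft_threshold_split]). The sup-norm bound for the pair [v], [w] and the
    exponential bound for [w] give, for almost every [x],
    [[
      |S v x| <= |S w x| + |(S v - S w) x|
              <= C0 * (exp (rho * (M - |x|) - t) * A + 1) * e.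
    ]]
    The exponential is at most 1 as soon as [M <= |x| + t / rho]. The radius
    therefore grows with both [|x|] and [t]; with the largest such integer [M],
    [1 + M] dominates, up to the factor [2 * (1 + rho)], both [1 + |x|] and
    [1 + t]. Splitting [(1 + M) ^ k] into the powers [l] and [k - l]
    ([space_time_weight_le]) turns the decay in [M] into the spatial weight
    times the decay in time, so [C1 = (A + 1) * (2 * (1 + rho)) ^ k].

    As [M] depends on [x], the bound above is needed for all [M] at once, off
    one null set: that is why [M] ranges over the integers. Thresholding the
    values of [v], rather than cutting [v] off in space, keeps the argument
    uniform in the three choices of [X]: it is a postcomposition with a
    nonexpansive map fixing 0, and such maps preserve essential boundedness,
    continuity and uniform continuity ([nonexpansive_stable]). *)

(** * Exponential against algebraic weights *)

Section weights.
Context {R : realType}.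
Implicit Types k l rho s t d M : R.

Lemma ge0_le_powR k s t : 0 <= k -> 0 <= s -> s <= t -> s `^ k <= t `^ k.
Proof.
by move=> k0 s0 st; rewrite ge0_ler_powR ?nnegrE// (le_trans s0).
Qed.

(** The [k]-th power of [1 + d <= (1 + k / rho) * (1 + rho / k * d)], by
    [1 + y <= exp y]. *)
Lemma powR1D_le_expR k rho d : 0 < k -> 0 < rho -> 0 <= d ->
  (1 + d) `^ k <= (1 + k / rho) `^ k * expR (rho * d).
Proof.
move=> k0 rho0 d0.
have kr0 : 0 < k / rho by rewrite divr_gt0.
have rk0 : 0 < rho / k by rewrite divr_gt0.
have -> : expR (rho * d) = expR (rho / k * d) `^ k.
  by rewrite -expRM; congr expR; field; lra.
rewrite -powRM; [|lra|exact: expR_ge0].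
apply: ge0_le_powR; [exact: ltW|lra|].
apply: (@le_trans _ _ ((1 + k / rho) * (1 + rho / k * d))); last first.
  by rewrite ler_wpM2l ?expR_ge1Dx//; lra.
have -> : (1 + k / rho) * (1 + rho / k * d) = 1 + d + (k / rho + rho / k * d).
  by field; lra.
have : 0 <= rho / k * d by apply: mulr_ge0 => //; exact: ltW.
lra.
Qed.

(** Since [1 + M <= (1 + (M - s)) * (1 + s)], passing from [s] to [M] costs at
    most a power of [1 + (M - s)], which [powR1D_le_expR] absorbs into the growth
    of the exponential. *)
Lemma expR_le_powR k rho s M : 0 < k -> 0 < rho -> 0 <= s -> s <= M ->
  expR (rho * s) * (1 + M) `^ k <=
  (1 + k / rho) `^ k * expR (rho * M) * (1 + s) `^ k.
Proof.
move=> k0 rho0 s0 sM.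
have le1 : (1 + M) `^ k <= (1 + (M - s)) `^ k * (1 + s) `^ k.
  rewrite -powRM; [|lra|lra].
  apply: ge0_le_powR; [exact: ltW|lra|].
  have : 0 <= (M - s) * s by apply: mulr_ge0; lra.
  lra.
have le2 := @powR1D_le_expR k rho (M - s) k0 rho0.
have -> : expR (rho * M) = expR (rho * s) * expR (rho * (M - s)).
  by rewrite -expRD; congr expR; ring.
apply: (le_trans (ler_wpM2l (expR_ge0 _) le1)).
set A := (1 + k / rho) `^ k; set e := expR (rho * s).
have -> : A * (e * expR (rho * (M - s))) * (1 + s) `^ k =
  e * (A * expR (rho * (M - s)) * (1 + s) `^ k) by ring.
by rewrite ler_wpM2l ?expR_ge0// ler_wpM2r ?powR_ge0// le2 ?subr_ge0.
Qed.

(** Both [1 + s] and [1 + t] are at most [B = 2 * (1 + rho) * (1 + M)], and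
    [B ^ k = B ^ l * B ^ (k - l)]. *)
Lemma space_time_weight_le k l rho s t M : 0 < l -> l < k -> 0 < rho ->
  0 <= s -> 0 < t -> 0 <= M -> s + t / rho < M + 1 ->
  (1 + s) `^ l * (1 + t) `^ (k - l) <= (2 * (1 + rho)) `^ k * (1 + M) `^ k.
Proof.
move=> l0 lk rho0 s0 t0 M0 sM.
have tr0 : 0 < t / rho by rewrite divr_gt0.
set B := 2 * (1 + rho) * (1 + M).
have sB : 1 + s <= B.
  have : 0 <= rho * (1 + M) by apply: mulr_ge0; lra.
  rewrite /B; lra.
have tB : 1 + t <= B.
  have : rho * (t / rho) < rho * (M + 1) by rewrite ltr_pM2l//; lra.
  have -> : rho * (t / rho) = t by field; lra.
  have : 0 <= rho * M by apply: mulr_ge0; lra.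
  rewrite /B; lra.
have B0 : 0 < B by lra.
rewrite -powRM; [|lra|lra].
rewrite -/B (_ : B `^ k = B `^ l * B `^ (k - l)); last first.
  by rewrite -powRD ?(gt_eqF B0) ?implybT//; congr powR; ring.
by apply: ler_pM; rewrite ?powR_ge0//; apply: ge0_le_powR; lra.
Qed.

End weights.

(** * Essential suprema *)

Section sup_norm.
Context {d} {T : measurableType d} {R : realType}.
Variable mu : {measure set T -> \bar R}.

Lemma ae_imply (P Q : T -> Prop) : (forall x, P x -> Q x) ->
  (\forall x \ae mu, P x) -> \forall x \ae mu, Q x.
Proof. exact: filterS. Qed.

Lemma ae_imply2 (P Q W : T -> Prop) : (forall x, P x -> Q x -> W x) ->
  (\forall x \ae mu, P x) -> (\forall x \ae mu, Q x) ->
  \forall x \ae mu, W x.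
Proof. exact: filterS2. Qed.

(** The zero measure, whose sup-norm is 0 by convention and for which every
    property holds almost everywhere, is the reason for [0 <= y]. *)
Lemma Lnormoo_leP (f : T -> \bar R) (y : \bar R) : (0 <= y)%E ->
  ('N[mu]_+oo[f] <= y)%E <-> \forall x \ae mu, (`|f x| <= y)%E.
Proof.
move=> y0; rewrite unlock; case: ifPn => [_|muT0].
  by split => [/ess_supP|h]//; apply/ess_supP.
split=> // _; exists setT; split => //.
by apply/eqP; rewrite eq_le measure_ge0 andbT leNgt.
Qed.

Lemma Lnormoo_weight_leP (w u : T -> R) (c : R) :
  (forall x, 0 <= w x) -> 0 <= c ->
  ('N[mu]_+oo[(fun x => (w x * `|u x|)%:E)] <= c%:E)%E <->
  \forall x \ae mu, w x * `|u x| <= c.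
Proof.
move=> w0 c0; rewrite Lnormoo_leP ?lee_fin//.
by split; apply: filterS => x; rewrite abse_EFin lee_fin normrM normr_id
  (ger0_norm (w0 x)).
Qed.

End sup_norm.

(** * Soft thresholding *)

Section soft_thresholding.
Context {R : realType}.
Implicit Types e c d : R.

Definition clip e c := Num.max (- e) (Num.min e c).
Definition shrink e c := c - clip e c.

Lemma normr_clip e c : 0 <= e -> `|clip e c| <= e.
Proof.
rewrite /clip /Num.min ler_norml; case: (ltP e c) => ec;
  by rewrite /Num.max; case: ltP; lra.
Qed.

Lemma shrink_eq0 e c : `|c| <= e -> shrink e c = 0.
Proof.
rewrite /shrink /clip /Num.min ler_norml; case: (ltP e c) => ec;
  by rewrite /Num.max; case: ltP; lra.
Qed.

Lemma shrink_nonexpansive e c d : 0 <= e -> `|shrink e c - shrink e d| <= `|c - d|.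
Proof.
rewrite ler_norml /shrink /clip /Num.min => e0.
case: (ltP e c) => ec; case: (ltP e d) => ed; rewrite /Num.max;
  case: (ltP (- e) e) => ?; case: (ltP (- e) c) => ?; case: (ltP (- e) d) => ?;
  by case: (lerP c d); lra.
Qed.

End soft_thresholding.

(** * Postcomposition with a nonexpansive map *)

Section postcomposition.
Context {R : realType} {g : R -> R}.
Hypotheses (g0 : g 0 = 0) (g1 : forall c d, `|g c - g d| <= `|c - d|).

Lemma nonexpansive_norm c : `|g c| <= `|c|.
Proof. by have := g1 c 0; rewrite g0 !subr0. Qed.

Lemma nonexpansive_unif_continuous : unif_continuous (g : R -> R).
Proof.
apply/unif_continuousP => e e0; exists e => // -[c d] /=.
by rewrite /ball /= => /(le_lt_trans (g1 _ _)).
Qed.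

Lemma nonexpansive_continuous : continuous (g : R -> R).
Proof.
move=> c; apply/cvgrPdist_lt => e e0; near=> d.
apply: (le_lt_trans (g1 _ _)); near: d.
by apply: cvgr_dist_lt.
Unshelve. all: by end_near. Qed.

Context {n : nat} {Omega : set (euclidean R n)} {mOmega : measurable Omega}.
Implicit Types (u : Linfty mOmega) (X : set (Linfty mOmega)).

Lemma nonexpansive_Linfty u : exists w : Linfty mOmega, w =1 g \o u.
Proof.
have mw : measurable_fun setT (g \o u).
  apply: measurableT_comp; last exact: measurable_funPT.
  exact: continuous_measurable_fun nonexpansive_continuous.
have fw : finite_norm (lebesgue_on mOmega) +oo (g \o u).
  rewrite /finite_norm.
  apply: (@le_lt_trans _ _ (supnorm u)); last exact: Lfunction_finite.
  apply/Lnormoo_leP; first exact: Lnorm_ge0.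
  have /Lnormoo_leP := lexx (supnorm u).
  move=> /(_ (Lnorm_ge0 _ _ _)); apply: filterS => x /=.
  by apply: le_trans; rewrite lee_fin nonexpansive_norm.
have Lw : (g \o u : _ -> R) \in Lfun (lebesgue_on mOmega) +oo.
  by rewrite inE; apply/andP; rewrite !inE.
by exists (Lfun_Sub (leey 1%E) Lw).
Qed.

(** The continuous, or uniformly continuous, representative of [w] is [g \o f],
    where [f] is that of [u]; it stays bounded because [|g c| <= |c|]. *)
Lemma nonexpansive_stable {X u} {w : Linfty mOmega} :
  [\/ X = setT, X = BC0 mOmega | X = LinftyUC mOmega] ->
  w =1 g \o u -> X u -> X w.
Proof.
move=> XE wE; case: XE => -> //.
- move=> [f [cf bf uf]]; exists (g \o f); split.
  + apply: within_continuous_comp cf => y _; exact: nonexpansive_continuous.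
  + have [B [Br HB]] := bf.
    exists B; split=> // b /HB {}HB x /HB /=; exact/le_trans/nonexpansive_norm.
  + by apply: filterS uf => x /= ufx xT; rewrite wE /= ufx.
- move=> [f [cf uf]]; exists (g \o f); split.
  + exact: cvg_comp cf nonexpansive_unif_continuous.
  + by apply: filterS uf => x /= ufx xT; rewrite wE /= ufx.
Qed.

End postcomposition.

(** * Splitting at a radius *)

Section splitting.
Context {R : realType} {n : nat} {Omega : set (euclidean R n)}.
Context {mOmega : measurable Omega}.
Implicit Types (u v w : Linfty mOmega) (X : set (Linfty mOmega)).
Local Notation mu := (lebesgue_on mOmega).

Lemma wnorm_leP (w : 'rV[R]_n.+1 -> R) u (c : R) :
  (forall x, 0 <= w x) -> 0 <= c ->
  (wnorm w u <= c%:E)%E <-> \forall x \ae mu, w x * `|u x| <= c.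
Proof.
by move=> w0 c0; exact: Lnormoo_weight_leP.
Qed.

Lemma supnorm_leP u (c : R) : 0 <= c ->
  (supnorm u <= c%:E)%E <-> \forall x \ae mu, `|u x| <= c.
Proof. by move=> c0; rewrite /supnorm (Lnormoo_leP mu) ?lee_fin. Qed.

Lemma enorm_ge0 (x : 'rV[R]_n.+1) : 0 <= enorm x.
Proof. exact: sqrtr_ge0. Qed.

(** The summand [w] is the soft thresholding of [v] at [e = N / (1 + M) ^ k].
    Where [w] does not vanish, [e < |v|] while [(1 + |x|) ^ k * |v| <= N]; this
    forces [|x| <= M], so that [expR_le_powR] compares the two weights. *)
Lemma soft_threshold_split {X v} {k rho M N : R} :
  [\/ X = setT, X = BC0 mOmega | X = LinftyUC mOmega] ->
  0 < k -> 0 < rho -> 0 <= M -> 0 <= N ->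
  X v -> (algnorm k v <= N%:E)%E ->
  exists w, [/\ expspace X rho w,
    (expnorm rho w <=
      ((1 + k / rho) `^ k * expR (rho * M) * (N / (1 + M) `^ k))%:E)%E &
    (supnorm (v - w)%R <= (N / (1 + M) `^ k)%:E)%E].
Proof.
move=> XE k0 rho0 M0 N0 Xv vN.
have M1 : 0 < (1 + M) `^ k by rewrite powR_gt0; lra.
have A0 : 0 <= (1 + k / rho) `^ k by exact: powR_ge0.
set e := N / (1 + M) `^ k.
have e0 : 0 <= e by rewrite divr_ge0// ltW.
have se0 : shrink e 0 = 0 by rewrite shrink_eq0 ?normr0.
have se1 c d : `|shrink e c - shrink e d| <= `|c - d| by exact: shrink_nonexpansive.
have [w wE] := nonexpansive_Linfty se0 se1 v.
have Xw : X w by exact: (nonexpansive_stable se0 se1 XE wE).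
have B0 : 0 <= (1 + k / rho) `^ k * expR (rho * M) * e.
  by rewrite mulr_ge0// mulr_ge0// expR_ge0.
have wexp : (expnorm rho w <=
    ((1 + k / rho) `^ k * expR (rho * M) * e)%:E)%E.
  apply/wnorm_leP => //.
  move/wnorm_leP : vN => /(_ (fun x => powR_ge0 _ _) N0).
  apply: ae_imply => x vx; rewrite wE /=.
  have [ve|ev] := lerP `|v x| e.
    by rewrite shrink_eq0// normr0 mulr0.
  have v0 : 0 < `|v x| by exact: le_lt_trans ev.
  have sx := enorm_ge0 x.
  apply: (@le_trans _ _ (expR (rho * enorm x) * `|v x|)).
    by rewrite ler_wpM2l ?expR_ge0 ?(nonexpansive_norm se0 se1).
  have sM : enorm x <= M.
    rewrite leNgt; apply/negP => Ms.
    have : (1 + M) `^ k <= (1 + enorm x) `^ k by apply: ge0_le_powR; lra.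
    move=> /(ler_wpM2r (ltW v0)) /le_trans /(_ vx).
    by rewrite mulrC -ler_pdivlMr// leNgt ev.
  rewrite -(ler_pM2l M1).
  have -> : (1 + M) `^ k * ((1 + k / rho) `^ k * expR (rho * M) * e) =
            (1 + k / rho) `^ k * expR (rho * M) * N.
    by rewrite /e; field; rewrite gt_eqF.
  apply: le_trans (ler_wpM2l (mulr_ge0 A0 (expR_ge0 _)) vx).
  rewrite !mulrA ler_wpM2r// mulrC.
  by apply: expR_le_powR.
exists w; split => //.
  by split=> //; apply: le_lt_trans wexp _; rewrite ltry.
apply/supnorm_leP => //; apply: aeW => x.
have -> : (v - w) x = v x - w x by [].
by rewrite wE /= /shrink subKr normr_clip.
Qed.

End splitting.

(** * Algebraic decay from exponential decay *)

Theorem theorem2p2 (R : realType) (k rho : R) (hk : 0 < k) (hrho : 0 < rho) :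
  exists C1 : R, 0 < C1 /\
    forall (n : nat) (Omega : set (euclidean R n)) (mOmega : measurable Omega)
      (X : set (Linfty mOmega)) (C0 t : R) (S : Linfty mOmega -> Linfty mOmega),
    ~ bounded_set (Omega : set 'rV[R]_n.+1) ->
    [\/ X = setT, X = BC0 mOmega | X = LinftyUC mOmega] ->
    0 < C0 -> 0 < t ->
    linear_on X S ->
    (forall u, X u -> X (S u)) ->
    (forall u, expspace X rho u -> expspace X rho (S u)) ->
    (forall u v, X u -> X v ->
      (supnorm (S u - S v)%R <= C0%:E * supnorm (u - v)%R)%E) ->
    (forall u, expspace X rho u ->
      (expnorm rho (S u) <= (C0 * expR (- t))%R%:E * expnorm rho u)%E) ->
    forall l : R, 0 < l -> l < k ->
      (forall v, algspace X k v -> algspace X l (S v)) /\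
      (forall v, algspace X k v ->
        (algnorm l (S v) <= (C0 * C1 / (1 + t) `^ (k - l))%R%:E * algnorm k v)%E).
Proof.
have kr0 : 0 < k / rho by rewrite divr_gt0.
set A := (1 + k / rho) `^ k; set D := (2 * (1 + rho)) `^ k.
have A0 : 0 < A by rewrite powR_gt0; lra.
have D0 : 0 < D by rewrite powR_gt0; lra.
exists ((A + 1) * D); split; first by rewrite mulr_gt0; lra.
move=> n Omega mOmega X C0 t S _ XE hC0 ht _ XS _ Slip Sexp l hl hlk.
suff main v : algspace X k v -> (algnorm l (S v) <=
    (C0 * ((A + 1) * D) / (1 + t) `^ (k - l))%R%:E * algnorm k v)%E.
  split=> // v vk; split; first exact: XS vk.1.
  apply: le_lt_trans (main v vk) _; case: vk => _ /=.
  have : (0 <= algnorm k v)%E by exact: Lnorm_ge0.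
  by case: algnorm => // N _ _; rewrite -EFinM ltry.
move=> [Xv vfin].
have [N N0 Nv] : exists2 N : R, 0 <= N & algnorm k v = N%:E.
  have := @Lnorm_ge0 _ _ _ (lebesgue_on mOmega) +oo%E
    (fun x => ((1 + enorm x) `^ k * `|v x|)%:E).
  move: vfin; rewrite /= /algnorm /wnorm.
  by case: ('N[_]_ _[_])%E => // N _; rewrite lee_fin => N0; exists N.
have T0 : 0 < (1 + t) `^ (k - l) by rewrite powR_gt0; lra.
have C10 : 0 < C0 * ((A + 1) * D) / (1 + t) `^ (k - l).
  by rewrite divr_gt0// !mulr_gt0//; lra.
rewrite Nv -EFinM; apply/wnorm_leP; [by move=> x; exact: powR_ge0|
  by rewrite mulr_ge0// ltW|].
(* [expR (rho * M)] comes from the exponential norm of [w] and is divided by the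
   weight [expR (rho * enorm x)] when that norm is read at the point [x]. *)
have step (M : nat) : \forall x \ae lebesgue_on mOmega,
    `|S v x| <= C0 * (expR (rho * (M%:R - enorm x) - t) * A + 1) *
                (N / (1 + M%:R) `^ k).
  have M0 : 0 <= M%:R :> R by [].
  have [] := soft_threshold_split XE hk hrho M0 N0 Xv; first by rewrite Nv.
  move=> w [wX wexp wsup].
  set e := N / (1 + M%:R) `^ k in wexp wsup *.
  have e0 : 0 <= e by rewrite divr_ge0// powR_ge0.
  have Swexp : (expnorm rho (S w) <=
      (C0 * expR (- t) * (A * expR (rho * M%:R) * e))%:E)%E.
    apply: le_trans (Sexp w wX) _; rewrite [X in (_ <= X)%E]EFinM lee_wpmul2l//.
    by rewrite lee_fin mulr_ge0 ?expR_ge0// ltW.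
  have Svw : (supnorm (S v - S w)%R <= (C0 * e)%:E)%E.
    apply: le_trans (Slip v w Xv wX.1) _; rewrite EFinM lee_wpmul2l//.
    by rewrite lee_fin ltW.
  move/wnorm_leP : Swexp => /(_ (fun=> expR_ge0 _)) /(_ _)/wrap[].
    by rewrite !mulr_ge0 ?expR_ge0// ltW.
  move/supnorm_leP : Svw => /(_ (mulr_ge0 (ltW hC0) e0)).
  apply: ae_imply2 => x.
  have -> : (S v - S w) x = S v x - S w x by [].
  move=> vw wx.
  have -> : expR (rho * (M%:R - enorm x) - t) =
      expR (- t) * expR (rho * M%:R) / expR (rho * enorm x).
    by rewrite -expRN -!expRD; congr expR; ring.
  have wx' : `|S w x| <= C0 * expR (- t) * (A * expR (rho * M%:R) * e) /
      expR (rho * enorm x) by rewrite ler_pdivlMr ?expR_gt0// mulrC.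
  have := ler_normD (S v x - S w x) (S w x); rewrite subrK => h.
  apply: (le_trans h); apply: (le_trans (lerD vw wx')).
  by rewrite le_eqVlt; apply/orP; left; apply/eqP; ring.
have := ae_foralln step; apply: ae_imply => x hx.
have sx := enorm_ge0 x.
have str : 0 <= enorm x + t / rho by rewrite addr_ge0// divr_ge0 ?ltW.
have /andP[Mle Mlt] := truncn_itv str.
(* The largest integer radius for which the exponential factor is at most 1. *)
move: (hx (Num.truncn (enorm x + t / rho))).
set M := (Num.truncn _)%:R in Mle *.
have M0 : 0 <= M by [].
rewrite -natr1 -/M in Mlt.
have ML := @space_time_weight_le _ k l rho (enorm x) t M hl hlk hrho sx ht M0 Mlt.
have M1 : 0 < (1 + M) `^ k by rewrite powR_gt0; lra.
have exp1 : expR (rho * (M - enorm x) - t) <= 1.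
  rewrite -expR0 ler_expR.
  have := ler_wpM2l (ltW hrho) Mle.
  have -> : rho * (enorm x + t / rho) = rho * enorm x + t by field; lra.
  lra.
move=> Sx.
have {}Sx : `|S v x| <= C0 * (A + 1) * (N / (1 + M) `^ k).
  apply: (le_trans Sx); rewrite ler_wpM2r ?divr_ge0 ?powR_ge0//.
  by rewrite ler_pM2l// lerD2r ler_piMl// ltW.
apply: (le_trans (ler_wpM2l (powR_ge0 _ _) Sx)).
rewrite [leRHS]mulrAC ler_pdivlMr//.
set a := (1 + enorm x) `^ l in ML *; set b := (1 + t) `^ (k - l) in ML *.
have -> : a * (C0 * (A + 1) * (N / (1 + M) `^ k)) * b =
   C0 * (A + 1) * N * ((a * b) / (1 + M) `^ k) by ring.
have -> : C0 * ((A + 1) * D) * N = C0 * (A + 1) * N * D by ring.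
rewrite ler_wpM2l//; first by rewrite !mulr_ge0//; lra.
by rewrite ler_pdivrMr.
Qed.
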